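(* Let $M=\mathbb{R}^2$ with coordinates $(x,y)$ and symplectic form $dx\wedge dy$, and let $\mathfrak{g}$ be the Lie algebra spanned by the functions $x^3,\ x^2,\ x,\ y,\ 1$ under the Poisson bracket $\{f,g\}=\partial_x f\,\partial_y g-\partial_y f\,\partial_x g$, acting on $C^\infty(\mathbb{R}^2)$ by Hamiltonian vector fields, i.e. $X\in\mathfrak{g}$ acts by $f\mapsto\{X,f\}$. Then there is no $\mathfrak{g}$-invariant star product on $(\mathbb{R}^2, dx\wedge dy)$. That is, there is no star product $\star$ on $C^\infty(\mathbb{R}^2)$ such that $\{X,f\star g\}=\{X,f\}\star g+f\star\{X,g\}$ for all $X\in\mathfrak{g}$ and all $f,g\in C^\infty(\mathbb{R}^2)$.
   Context: $C^\infty(\mathbb{R}^2)$ denotes complex-valued smooth functions, and $\hbar$ is a formal parameter. A star product on $C^\infty(\mathbb{R}^2)$ is an associative, $\mathbb{C}[[\hbar]]$-bilinear product on $C^\infty(\mathbb{R}^2)[[\hbar]]$ of the form $f\star g=\sum_{r\ge 0}\hbar^r C^r(f,g)$ for $f,g\in C^\infty(\mathbb{R}^2)$, such that: (1) each $C^r$ is a (local) bidifferential operator, i.e. $C^r=\sum_{i,j,k,l\ge 0}C^r_{ij;kl}\,\partial_x^i\partial_y^j\otimes\partial_x^k\partial_y^l$ with smooth complex-valued coefficient functions $C^r_{ij;kl}$ on $\mathbb{R}^2$ (a finite sum), acting by $C^r(f,g)=\sum C^r_{ij;kl}\,(\partial_x^i\partial_y^j f)(\partial_x^k\partial_y^l g)$;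 (2) $C^0(f,g)=fg$ is the pointwise product; (3) $f\star g-g\star f=-i\hbar\{f,g\}+(\text{terms of order}\ge 2\text{ in }\hbar)$, where $i=\sqrt{-1}$, i.e. $C^1(f,g)-C^1(g,f)=-i\{f,g\}$. The bracket $\{X,\cdot\}$ is extended $\hbar$-linearly to $C^\infty(\mathbb{R}^2)[[\hbar]]$. With these conventions the elements $x^3,x^2,x,y,1$ of $\mathfrak{g}$ act by the vector fields $3x^2\partial_y,\ 2x\partial_y,\ \partial_y,\ -\partial_x,\ 0$ respectively. *)

(* Defs.v *)
From Stdlib Require Import Reals Arith FunctionalExtensionality ProofIrrelevance.
From Coquelicot Require Import Coquelicot.

Definition smoothR (f : R -> R -> R) : Prop :=
  forall (n : nat) (x y : R), ex_diff_n f n x y.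

Definition smooth (f : R -> R -> C) : Prop :=
  smoothR (fun x y => Re (f x y)) /\ smoothR (fun x y => Im (f x y)).

Record Cinf : Type := mkCinf {
  Cinf_fun :> R -> R -> C;
  Cinf_smooth : smooth Cinf_fun
}.

Lemma Cinf_ext (f g : Cinf) : (forall x y, f x y = g x y) -> f = g.
Proof.
destruct f as [f Hf], g as [g Hg]; simpl; intros H.
assert (E : f = g).
{ apply functional_extensionality; intros x.
  apply functional_extensionality; intros y; apply H. }
subst g; f_equal; apply proof_irrelevance.
Qed.

Lemma smoothR_ext (f g : R -> R -> R) :
  (forall x y, f x y = g x y) -> smoothR f -> smoothR g.
Proof.
intros H Hf n x y; apply ex_diff_n_ext_loc with f; [|apply Hf].
exists (mkposreal 1 Rlt_0_1); intros; apply H.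
Qed.

Lemma smoothR_d1 (f : R -> R -> R) :
  smoothR f -> smoothR (fun x y => Derive (fun t => f t y) x).
Proof. intros H n x y; apply (H (S n)). Qed.

Lemma smoothR_d2 (f : R -> R -> R) :
  smoothR f -> smoothR (fun x y => Derive (fun t => f x t) y).
Proof. intros H n x y; apply (H (S n)). Qed.

Lemma ex_diff_n_ext (f g : R -> R -> R) n x y :
  (forall x y, f x y = g x y) -> ex_diff_n f n x y -> ex_diff_n g n x y.
Proof.
intros H; apply ex_diff_n_ext_loc.
exists (mkposreal 1 Rlt_0_1); intros; apply H.
Qed.

Lemma smoothR_const (c : R) : smoothR (fun _ _ => c).
Proof.
intros n; revert c; induction n as [|n IH]; intros c x y; simpl.
- split; [apply continuity_2d_pt_const | exact I].
- repeat split; try apply continuity_2d_pt_const; try apply ex_derive_const.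
  + apply ex_diff_n_ext with (fun _ _ => 0); [|apply IH].
    intros; symmetry; apply Derive_const.
  + apply ex_diff_n_ext with (fun _ _ => 0); [|apply IH].
    intros; symmetry; apply Derive_const.
Qed.

Lemma smoothR_fst : smoothR (fun x _ => x).
Proof.
intros [|n] x y; simpl.
- split; [apply continuity_2d_pt_id1 | exact I].
- repeat split.
  + apply continuity_2d_pt_id1.
  + apply ex_derive_id.
  + apply ex_derive_const.
  + apply ex_diff_n_ext with (fun _ _ => 1); [|apply smoothR_const].
    intros; symmetry; apply Derive_id.
  + apply ex_diff_n_ext with (fun _ _ => 0); [|apply smoothR_const].
    intros; symmetry; apply Derive_const.
Qed.

Lemma smoothR_snd : smoothR (fun _ y => y).
Proof.
intros [|n] x y; simpl.
- split; [apply continuity_2d_pt_id2 | exact I].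
- repeat split.
  + apply continuity_2d_pt_id2.
  + apply ex_derive_const.
  + apply ex_derive_id.
  + apply ex_diff_n_ext with (fun _ _ => 0); [|apply smoothR_const].
    intros; symmetry; apply Derive_const.
  + apply ex_diff_n_ext with (fun _ _ => 1); [|apply smoothR_const].
    intros; symmetry; apply Derive_id.
Qed.

Lemma ex_diff_n_cont (f : R -> R -> R) n x y :
  ex_diff_n f n x y -> continuity_2d_pt f x y.
Proof. destruct n; intros H; apply (proj1 H). Qed.

Lemma ex_diff_n_ex1 (f : R -> R -> R) n x y :
  ex_diff_n f (S n) x y -> ex_derive (fun t => f t y) x.
Proof. intros H; exact (proj1 (proj2 H)). Qed.

Lemma ex_diff_n_ex2 (f : R -> R -> R) n x y :
  ex_diff_n f (S n) x y -> ex_derive (fun t => f x t) y.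
Proof. intros H; exact (proj1 (proj2 (proj2 H))). Qed.

Lemma ex_diff_n_plus (n : nat) : forall (f g : R -> R -> R),
  (forall x y, ex_diff_n f n x y) -> (forall x y, ex_diff_n g n x y) ->
  forall x y, ex_diff_n (fun x y => f x y + g x y) n x y.
Proof.
induction n as [|n IH]; intros f g Hf Hg x y.
- split; [|exact I].
  apply continuity_2d_pt_plus; eapply ex_diff_n_cont; auto.
- split; [|split; [|split; [|split]]].
  + apply continuity_2d_pt_plus; eapply ex_diff_n_cont; auto.
  + apply (@ex_derive_plus R_AbsRing R_NormedModule
             (fun t => f t y) (fun t => g t y));
      eapply ex_diff_n_ex1; auto.
  + apply (@ex_derive_plus R_AbsRing R_NormedModule
             (fun t => f x t) (fun t => g x t));
      eapply ex_diff_n_ex2; auto.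
  + apply ex_diff_n_ext with
      (fun u v => Derive (fun t => f t v) u + Derive (fun t => g t v) u).
    * intros u v; symmetry.
      apply (Derive_plus (fun t => f t v) (fun t => g t v));
        eapply ex_diff_n_ex1; auto.
    * apply IH; intros; apply ex_diff_n_deriv_aux1; auto.
  + apply ex_diff_n_ext with
      (fun u v => Derive (fun t => f u t) v + Derive (fun t => g u t) v).
    * intros u v; symmetry.
      apply (Derive_plus (fun t => f u t) (fun t => g u t));
        eapply ex_diff_n_ex2; auto.
    * apply IH; intros; apply ex_diff_n_deriv_aux2; auto.
Qed.

Lemma ex_diff_n_mult (n : nat) : forall (f g : R -> R -> R),
  (forall x y, ex_diff_n f n x y) -> (forall x y, ex_diff_n g n x y) ->
  forall x y, ex_diff_n (fun x y => f x y * g x y) n x y.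
Proof.
induction n as [|n IH]; intros f g Hf Hg x y.
- split; [|exact I].
  apply continuity_2d_pt_mult; eapply ex_diff_n_cont; auto.
- assert (Hf1 : forall x y, ex_diff_n f n x y)
    by (intros; apply ex_diff_n_m with (S n); auto).
  assert (Hg1 : forall x y, ex_diff_n g n x y)
    by (intros; apply ex_diff_n_m with (S n); auto).
  split; [|split; [|split; [|split]]].
  + apply continuity_2d_pt_mult; eapply ex_diff_n_cont; auto.
  + apply (ex_derive_mult
             (fun t => f t y) (fun t => g t y));
      eapply ex_diff_n_ex1; auto.
  + apply (ex_derive_mult
             (fun t => f x t) (fun t => g x t));
      eapply ex_diff_n_ex2; auto.
  + apply ex_diff_n_ext with
      (fun u v => Derive (fun t => f t v) u * g u v
                + f u v * Derive (fun t => g t v) u).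
    * intros u v; symmetry.
      apply (Derive_mult (fun t => f t v) (fun t => g t v));
        eapply ex_diff_n_ex1; auto.
    * apply ex_diff_n_plus; apply IH; auto;
        intros; apply ex_diff_n_deriv_aux1; auto.
  + apply ex_diff_n_ext with
      (fun u v => Derive (fun t => f u t) v * g u v
                + f u v * Derive (fun t => g u t) v).
    * intros u v; symmetry.
      apply (Derive_mult (fun t => f u t) (fun t => g u t));
        eapply ex_diff_n_ex2; auto.
    * apply ex_diff_n_plus; apply IH; auto;
        intros; apply ex_diff_n_deriv_aux2; auto.
Qed.

Lemma smoothR_plus (f g : R -> R -> R) :
  smoothR f -> smoothR g -> smoothR (fun x y => f x y + g x y).
Proof. intros Hf Hg n; apply ex_diff_n_plus; [apply Hf | apply Hg]. Qed.

Lemma smoothR_mult (f g : R -> R -> R) :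
  smoothR f -> smoothR g -> smoothR (fun x y => f x y * g x y).
Proof. intros Hf Hg n; apply ex_diff_n_mult; [apply Hf | apply Hg]. Qed.

Lemma smoothR_opp (f : R -> R -> R) :
  smoothR f -> smoothR (fun x y => - f x y).
Proof.
intros Hf; apply smoothR_ext with (fun x y => (-1) * f x y).
- intros; ring.
- apply (smoothR_mult (fun _ _ => -1)); [apply smoothR_const | exact Hf].
Qed.

Lemma smooth_plus (f g : R -> R -> C) :
  smooth f -> smooth g -> smooth (fun x y => Cplus (f x y) (g x y)).
Proof.
intros [Hf1 Hf2] [Hg1 Hg2]; split; simpl; apply smoothR_plus; assumption.
Qed.

Lemma smooth_opp (f : R -> R -> C) :
  smooth f -> smooth (fun x y => Copp (f x y)).
Proof. intros [Hf1 Hf2]; split; simpl; apply smoothR_opp; assumption. Qed.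

Lemma smooth_mult (f g : R -> R -> C) :
  smooth f -> smooth g -> smooth (fun x y => Cmult (f x y) (g x y)).
Proof.
intros [Hf1 Hf2] [Hg1 Hg2]; split; simpl.
- apply (smoothR_plus (fun x y => Re (f x y) * Re (g x y))
                      (fun x y => - (Im (f x y) * Im (g x y)))).
  + apply smoothR_mult; assumption.
  + apply smoothR_opp, smoothR_mult; assumption.
- apply (smoothR_plus (fun x y => Re (f x y) * Im (g x y))
                      (fun x y => Im (f x y) * Re (g x y)));
    apply smoothR_mult; assumption.
Qed.

Lemma smooth_const (c : C) : smooth (fun _ _ => c).
Proof. split; [exact (smoothR_const (Re c)) | exact (smoothR_const (Im c))]. Qed.

Lemma smooth_fst : smooth (fun x _ => RtoC x).
Proof. split; [exact smoothR_fst | exact (smoothR_const 0)]. Qed.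

Lemma smooth_snd : smooth (fun _ y => RtoC y).
Proof. split; [exact smoothR_snd | exact (smoothR_const 0)]. Qed.

Definition Cinf_plus (f g : Cinf) : Cinf :=
  mkCinf _ (smooth_plus f g (Cinf_smooth f) (Cinf_smooth g)).

Definition Cinf_opp (f : Cinf) : Cinf :=
  mkCinf _ (smooth_opp f (Cinf_smooth f)).

Definition Cinf_mult (f g : Cinf) : Cinf :=
  mkCinf _ (smooth_mult f g (Cinf_smooth f) (Cinf_smooth g)).

Definition Cinf_const (c : C) : Cinf := mkCinf _ (smooth_const c).

Definition Cinf_scal (c : C) (f : Cinf) : Cinf := Cinf_mult (Cinf_const c) f.

Definition Cinf_AbelianMonoid_mixin : AbelianMonoid.mixin_of Cinf.
Proof.
apply (AbelianMonoid.Mixin Cinf Cinf_plus (Cinf_const (RtoC 0)));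
  intros; apply Cinf_ext; intros; simpl; ring.
Defined.

Canonical Cinf_AbelianMonoid :=
  AbelianMonoid.Pack Cinf Cinf_AbelianMonoid_mixin Cinf.

Definition Cinf_AbelianGroup_mixin : AbelianGroup.mixin_of Cinf_AbelianMonoid.
Proof.
apply (AbelianGroup.Mixin Cinf_AbelianMonoid Cinf_opp);
  intros; apply Cinf_ext; intros; simpl; ring.
Defined.

Canonical Cinf_AbelianGroup :=
  AbelianGroup.Pack Cinf
    (AbelianGroup.Class Cinf Cinf_AbelianMonoid_mixin Cinf_AbelianGroup_mixin)
    Cinf.

Definition Cinf_Ring_mixin : Ring.mixin_of Cinf_AbelianGroup.
Proof.
apply (Ring.Mixin Cinf_AbelianGroup Cinf_mult (Cinf_const (RtoC 1)));
  intros; apply Cinf_ext; intros; simpl; ring.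
Defined.

Canonical Cinf_Ring :=
  Ring.Pack Cinf
    (Ring.Class Cinf (AbelianGroup.Class Cinf Cinf_AbelianMonoid_mixin
                        Cinf_AbelianGroup_mixin) Cinf_Ring_mixin)
    Cinf.

Definition Cinf_ModuleSpace_mixin :
  ModuleSpace.mixin_of C_Ring Cinf_AbelianGroup.
Proof.
apply (ModuleSpace.Mixin C_Ring Cinf_AbelianGroup Cinf_scal);
  intros; apply Cinf_ext; intros; simpl;
  unfold plus, mult, one; simpl; ring.
Defined.

Canonical Cinf_ModuleSpace :=
  ModuleSpace.Pack C_Ring Cinf
    (ModuleSpace.Class C_Ring Cinf
       (AbelianGroup.Class Cinf Cinf_AbelianMonoid_mixin
          Cinf_AbelianGroup_mixin) Cinf_ModuleSpace_mixin)
    Cinf.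

Lemma smooth_d1 (f : R -> R -> C) : smooth f ->
  smooth (fun x y => (Derive (fun t => Re (f t y)) x,
                      Derive (fun t => Im (f t y)) x)).
Proof.
intros [H1 H2]; split; [apply (smoothR_d1 _ H1) | apply (smoothR_d1 _ H2)].
Qed.

Lemma smooth_d2 (f : R -> R -> C) : smooth f ->
  smooth (fun x y => (Derive (fun t => Re (f x t)) y,
                      Derive (fun t => Im (f x t)) y)).
Proof.
intros [H1 H2]; split; [apply (smoothR_d2 _ H1) | apply (smoothR_d2 _ H2)].
Qed.

Definition dx (f : Cinf) : Cinf := mkCinf _ (smooth_d1 f (Cinf_smooth f)).

Definition dy (f : Cinf) : Cinf := mkCinf _ (smooth_d2 f (Cinf_smooth f)).

Definition dxy (i j : nat) (f : Cinf) : Cinf :=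
  Nat.iter i dx (Nat.iter j dy f).

Definition bracket (f g : Cinf) : Cinf :=
  minus (mult (dx f) (dy g)) (mult (dy f) (dx g)).

Definition coord_x : Cinf := mkCinf _ smooth_fst.
Definition coord_y : Cinf := mkCinf _ smooth_snd.

(** The span is taken over the reals: these functions are the Hamiltonians of
    the real vector fields of the action. *)
Definition in_g (X : Cinf) : Prop :=
  exists a b c d e : R,
    X = plus (scal (RtoC a) (pow_n coord_x 3))
       (plus (scal (RtoC b) (pow_n coord_x 2))
       (plus (scal (RtoC c) coord_x)
       (plus (scal (RtoC d) coord_y)
             (scal (RtoC e) (one : Cinf))))).

(** Formal power series in hbar with coefficients in C and in C^oo(R^2), as
    sequences of coefficients; [Cinfh_scal] is the Cauchy product. *)

Definition Ch : Type := nat -> C.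
Definition Cinfh : Type := nat -> Cinf.

Definition Cinfh_plus (F G : Cinfh) : Cinfh := fun n => plus (F n) (G n).

Definition Cinfh_scal (a : Ch) (F : Cinfh) : Cinfh :=
  fun n => sum_n (fun k => scal (a k) (F (n - k)%nat)) n.

Definition embed (f : Cinf) : Cinfh :=
  fun n => match n with O => f | S _ => zero end.

Definition bracket_h (X : Cinf) (F : Cinfh) : Cinfh :=
  fun n => bracket X (F n).

Definition bidifferential (B : Cinf -> Cinf -> Cinf) : Prop :=
  exists (N : nat) (c : nat -> nat -> nat -> nat -> Cinf),
  forall f g : Cinf,
    B f g = sum_n (fun i => sum_n (fun j => sum_n (fun k => sum_n (fun l =>
              mult (c i j k l) (mult (dxy i j f) (dxy k l g))) N) N) N) N.

(** The bilinear maps C^r are determined by the product: C^r(f, g) is the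
    coefficient of hbar^r in the product of [embed f] and [embed g]. *)
Definition star_coef (star : Cinfh -> Cinfh -> Cinfh) (r : nat) (f g : Cinf) :
  Cinf := star (embed f) (embed g) r.

Record star_product : Type := {
  star :> Cinfh -> Cinfh -> Cinfh;
  star_assoc : forall F G H : Cinfh,
    star (star F G) H = star F (star G H);
  star_plus_l : forall F G H : Cinfh,
    star (Cinfh_plus F G) H = Cinfh_plus (star F H) (star G H);
  star_plus_r : forall F G H : Cinfh,
    star F (Cinfh_plus G H) = Cinfh_plus (star F G) (star F H);
  star_scal_l : forall (a : Ch) (F G : Cinfh),
    star (Cinfh_scal a F) G = Cinfh_scal a (star F G);
  star_scal_r : forall (a : Ch) (F G : Cinfh),
    star F (Cinfh_scal a G) = Cinfh_scal a (star F G);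
  star_bidifferential : forall r : nat, bidifferential (star_coef star r);
  star_classical : forall f g : Cinf, star_coef star 0 f g = mult f g;
  star_semiclassical : forall f g : Cinf,
    minus (star_coef star 1 f g) (star_coef star 1 g f)
    = scal (Copp Ci) (bracket f g)
}.

Definition g_invariant (S : star_product) : Prop :=
  forall X : Cinf, in_g X -> forall f g : Cinf,
    bracket_h X (S (embed f) (embed g))
    = Cinfh_plus (S (embed (bracket X f)) (embed g))
                 (S (embed f) (embed (bracket X g))).

(* Main.v *)
From Stdlib Require Import Reals Lra Lia FunctionalExtensionality.
From Coquelicot Require Import Coquelicot.
Require Import Defs.

(** Write [C^r] for the coefficient of hbar^r in the product. Invariance under
    the functions x, y, x^2, x^3 says that each [C^r] commutes with the vector
    fields d/dx, d/dy, x d/dy and x^2 d/dy. The first two make [C^r] a constant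
    coefficient operator. Writing its symbol as p(xi1, eta1, xi2, eta2), the
    other two say that eta1 p_xi1 + eta2 p_xi2 = 0 and
    eta1 p_xi1xi1 + eta2 p_xi2xi2 = 0, which force
    p = a(eta1, eta2) + b(eta1, eta2) (xi1 eta2 - xi2 eta1). Thus no [C^r] can
    differentiate more than once in total with respect to x. But associativity
    at order hbar^2 involves C^1(C^1(f, g), h), in whose symbol
    xi1^2 eta2 eta3 has the coefficient b(0, 0)^2 that no other term can
    cancel, and b(0, 0) = -i/2 by the semiclassical condition.

    It suffices to test this on monomials. The monomials dual to
    xi1^2 eta2 eta3 are x^2, y, y, so the contradiction is read off from the
    order hbar^2 part of (x^2 * y) * y = x^2 * (y * y) at the origin. There the
    terms in [C^2] vanish ([ev_xxy_y], [ev_xx_yy]), and so does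
    C^1(x^2, C^1(y, y)) ([ev_B_xx_B]), whereas C^1(C^1(x^2, y), y) equals
    2 b^2 with b = C^1(x, y)(0) ([ev_B_B_xx_y]). The needed vanishing comes
    from evaluating at the origin, where x d/dy and x^2 d/dy are zero: each
    invariance identity becomes a linear relation between the numbers
    B(f, g)(0) for monomials f, g, which are multiples of the coefficients of
    the symbol of B. *)

Declare Scope Cinf_scope.
Delimit Scope Cinf_scope with F.
Bind Scope Cinf_scope with Cinf.
Local Infix "+" := Cinf_plus : Cinf_scope.
Local Infix "*" := Cinf_mult : Cinf_scope.
Local Notation "- f" := (Cinf_opp f) : Cinf_scope.
Local Notation "0" := (Cinf_const (RtoC 0)) : Cinf_scope.
Local Notation "1" := (Cinf_const (RtoC 1)) : Cinf_scope.
Local Notation x := coord_x.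
Local Notation y := coord_y.
Local Notation "'cst' c" := (Cinf_const c) (at level 9, c at level 9).

(** * Calculus in the ring of smooth functions *)

Lemma Cinf_ring_theory :
  ring_theory 0%F 1%F Cinf_plus Cinf_mult
    (fun f g => f + - g)%F Cinf_opp (@eq Cinf).
Proof.
constructor; intros; try reflexivity; apply Cinf_ext; intros; simpl; ring.
Qed.

Add Ring Cinf_ring : Cinf_ring_theory.

Lemma smoothR_ex_derive1 f u v :
  smoothR f -> ex_derive (fun t => f t v) u.
Proof. intros H; exact (ex_diff_n_ex1 f 0 u v (H 1%nat u v)). Qed.

Lemma smoothR_ex_derive2 f u v :
  smoothR f -> ex_derive (fun t => f u t) v.
Proof. intros H; exact (ex_diff_n_ex2 f 0 u v (H 1%nat u v)). Qed.

Lemma Cinf_ex_derive (f : Cinf) u v :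
  (ex_derive (fun t => Re (f t v)) u /\ ex_derive (fun t => Im (f t v)) u) /\
  (ex_derive (fun t => Re (f u t)) v /\ ex_derive (fun t => Im (f u t)) v).
Proof.
destruct (Cinf_smooth f) as [Hr Hi].
repeat split;
  [ apply (smoothR_ex_derive1 (fun a b => Re (f a b)))
  | apply (smoothR_ex_derive1 (fun a b => Im (f a b)))
  | apply (smoothR_ex_derive2 (fun a b => Re (f a b)))
  | apply (smoothR_ex_derive2 (fun a b => Im (f a b))) ]; assumption.
Qed.

Lemma Derive_Re_mult (a b c d : R -> R) t :
  ex_derive a t -> ex_derive b t -> ex_derive c t -> ex_derive d t ->
  Derive (fun s => a s * c s - b s * d s) t =
  (Derive a t * c t - Derive b t * d t + (a t * Derive c t - b t * Derive d t))%R.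
Proof.
intros; apply is_derive_unique; auto_derive; [tauto |].
change (fun s => a s) with a; change (fun s => b s) with b.
change (fun s => c s) with c; change (fun s => d s) with d; ring.
Qed.

Lemma Derive_Im_mult (a b c d : R -> R) t :
  ex_derive a t -> ex_derive b t -> ex_derive c t -> ex_derive d t ->
  Derive (fun s => a s * d s + b s * c s) t =
  (Derive a t * d t + Derive b t * c t + (a t * Derive d t + b t * Derive c t))%R.
Proof.
intros; apply is_derive_unique; auto_derive; [tauto |].
change (fun s => a s) with a; change (fun s => b s) with b.
change (fun s => c s) with c; change (fun s => d s) with d; ring.
Qed.

Lemma dx_plus f g : dx (f + g)%F = (dx f + dx g)%F.
Proof.
apply Cinf_ext; intros u v.
destruct (Cinf_ex_derive f u v) as [[? ?] _].
destruct (Cinf_ex_derive g u v) as [[? ?] _].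
apply injective_projections.
- apply (Derive_plus (fun t => Re (f t v)) (fun t => Re (g t v))); assumption.
- apply (Derive_plus (fun t => Im (f t v)) (fun t => Im (g t v))); assumption.
Qed.

Lemma dx_mult f g : dx (f * g)%F = (dx f * g + f * dx g)%F.
Proof.
apply Cinf_ext; intros u v.
destruct (Cinf_ex_derive f u v) as [[? ?] _].
destruct (Cinf_ex_derive g u v) as [[? ?] _].
apply injective_projections.
- apply (Derive_Re_mult (fun t => Re (f t v)) (fun t => Im (f t v))
           (fun t => Re (g t v)) (fun t => Im (g t v))); assumption.
- apply (Derive_Im_mult (fun t => Re (f t v)) (fun t => Im (f t v))
           (fun t => Re (g t v)) (fun t => Im (g t v))); assumption.
Qed.

Lemma dy_plus f g : dy (f + g)%F = (dy f + dy g)%F.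
Proof.
apply Cinf_ext; intros u v.
destruct (Cinf_ex_derive f u v) as [_ [? ?]].
destruct (Cinf_ex_derive g u v) as [_ [? ?]].
apply injective_projections.
- apply (Derive_plus (fun t => Re (f u t)) (fun t => Re (g u t))); assumption.
- apply (Derive_plus (fun t => Im (f u t)) (fun t => Im (g u t))); assumption.
Qed.

Lemma dy_mult f g : dy (f * g)%F = (dy f * g + f * dy g)%F.
Proof.
apply Cinf_ext; intros u v.
destruct (Cinf_ex_derive f u v) as [_ [? ?]].
destruct (Cinf_ex_derive g u v) as [_ [? ?]].
apply injective_projections.
- apply (Derive_Re_mult (fun t => Re (f u t)) (fun t => Im (f u t))
           (fun t => Re (g u t)) (fun t => Im (g u t))); assumption.
- apply (Derive_Im_mult (fun t => Re (f u t)) (fun t => Im (f u t))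
           (fun t => Re (g u t)) (fun t => Im (g u t))); assumption.
Qed.

Lemma dx_const c : dx (cst c) = 0%F.
Proof.
apply Cinf_ext; intros u v; apply injective_projections; simpl;
  first [apply Derive_const | apply Derive_id].
Qed.

Lemma dy_const c : dy (cst c) = 0%F.
Proof.
apply Cinf_ext; intros u v; apply injective_projections; simpl;
  first [apply Derive_const | apply Derive_id].
Qed.

Lemma dx_x : dx x = 1%F.
Proof.
apply Cinf_ext; intros u v; apply injective_projections; simpl;
  first [apply Derive_const | apply Derive_id].
Qed.

Lemma dy_x : dy x = 0%F.
Proof.
apply Cinf_ext; intros u v; apply injective_projections; simpl;
  first [apply Derive_const | apply Derive_id].
Qed.

Lemma dx_y : dx y = 0%F.
Proof.
apply Cinf_ext; intros u v; apply injective_projections; simpl;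
  first [apply Derive_const | apply Derive_id].
Qed.

Lemma dy_y : dy y = 1%F.
Proof.
apply Cinf_ext; intros u v; apply injective_projections; simpl;
  first [apply Derive_const | apply Derive_id].
Qed.

Create HintDb derivation.
#[local] Hint Rewrite dx_plus dy_plus dx_mult dy_mult dx_const dy_const
  dx_x dy_x dx_y dy_y : derivation.

Ltac derive := autorewrite with derivation; ring.

Lemma Cplus_self_0 (a : C) : Cplus a a = RtoC 0 -> a = RtoC 0.
Proof.
intros H.
replace a with (Cdiv (Cplus a a) (RtoC 2)).
- rewrite H; unfold Cdiv; ring.
- apply injective_projections; simpl; field.
Qed.

Lemma constant_of_Derive_0 (h : R -> R) (a b : R) :
  (forall t, ex_derive h t) -> (forall t, Derive h t = 0%R) -> h a = h b.
Proof.
intros Hex H0.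
assert (Hd : forall t, is_derive h t zero).
{ intros t; change (@zero R_NormedModule) with 0%R; rewrite <- (H0 t).
  apply Derive_correct, Hex. }
destruct (Rtotal_order a b) as [Hab | [-> | Hab]].
- apply (eq_is_derive h a b); auto.
- reflexivity.
- symmetry; apply (eq_is_derive h b a); auto.
Qed.

Lemma const_of_partials_0 (f : Cinf) :
  dx f = 0%F -> dy f = 0%F -> f = cst (f 0%R 0%R).
Proof.
intros Hx Hy.
assert (Ex : forall u v, dx f u v = RtoC 0) by (intros; rewrite Hx; reflexivity).
assert (Ey : forall u v, dy f u v = RtoC 0) by (intros; rewrite Hy; reflexivity).
apply Cinf_ext; intros u v; simpl.
transitivity (f 0%R v); apply injective_projections.
- apply (constant_of_Derive_0 (fun t => Re (f t v))); intros t.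
  + exact (proj1 (proj1 (Cinf_ex_derive f t v))).
  + exact (f_equal fst (Ex t v)).
- apply (constant_of_Derive_0 (fun t => Im (f t v))); intros t.
  + exact (proj2 (proj1 (Cinf_ex_derive f t v))).
  + exact (f_equal snd (Ex t v)).
- apply (constant_of_Derive_0 (fun t => Re (f 0%R t))); intros t.
  + exact (proj1 (proj2 (Cinf_ex_derive f 0%R t))).
  + exact (f_equal fst (Ey 0%R t)).
- apply (constant_of_Derive_0 (fun t => Im (f 0%R t))); intros t.
  + exact (proj2 (proj2 (Cinf_ex_derive f 0%R t))).
  + exact (f_equal snd (Ey 0%R t)).
Qed.

Definition ev (f : Cinf) : C := f 0%R 0%R.

Lemma ev_plus f g : ev (f + g)%F = Cplus (ev f) (ev g).
Proof. reflexivity. Qed.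

Lemma ev_0 : ev 0%F = RtoC 0.
Proof. reflexivity. Qed.

Lemma ev_cst c f : ev (cst c * f)%F = Cmult c (ev f).
Proof. reflexivity. Qed.

(** On polynomial arguments this recovers an invariant operator from its values
    at the origin, since its partial derivatives are again values of it on
    polynomials of lower degree. *)
Lemma eq_of_partials (f g : Cinf) :
  dx f = dx g -> dy f = dy g -> ev f = ev g -> f = g.
Proof.
intros Hx Hy H0.
assert (E : (f + - g)%F = cst (ev (f + - g)%F)).
{ apply const_of_partials_0.
  - replace (- g)%F with (cst (Copp (RtoC 1)) * g)%F
      by (apply Cinf_ext; intros; simpl; ring).
    rewrite dx_plus, dx_mult, dx_const, Hx.
    apply Cinf_ext; intros; simpl; ring.
  - replace (- g)%F with (cst (Copp (RtoC 1)) * g)%F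
      by (apply Cinf_ext; intros; simpl; ring).
    rewrite dy_plus, dy_mult, dy_const, Hy.
    apply Cinf_ext; intros; simpl; ring. }
replace f with (f + - g + g)%F by ring.
rewrite E; apply Cinf_ext; intros u v; unfold ev in *; simpl; rewrite H0; ring.
Qed.

(** * Bilinear operators invariant under the Lie algebra *)

Record invariant_bilinear (B : Cinf -> Cinf -> Cinf) : Prop := {
  inv_plus_l : forall f g h, B (f + g)%F h = (B f h + B g h)%F;
  inv_plus_r : forall f g h, B f (g + h)%F = (B f g + B f h)%F;
  inv_scal_l : forall c f g, B (cst c * f)%F g = (cst c * B f g)%F;
  inv_scal_r : forall c f g, B f (cst c * g)%F = (cst c * B f g)%F;
  inv_dx : forall f g, dx (B f g) = (B (dx f) g + B f (dx g))%F;
  inv_dy : forall f g, dy (B f g) = (B (dy f) g + B f (dy g))%F;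
  inv_xdy : forall f g,
    (x * dy (B f g) = B (x * dy f) g + B f (x * dy g))%F;
  inv_xxdy : forall f g,
    (x * x * dy (B f g) = B (x * x * dy f) g + B f (x * x * dy g))%F
}.

Section InvariantBilinear.

Variable B : Cinf -> Cinf -> Cinf.
Hypothesis HB : invariant_bilinear B.

Lemma inv_0_l f : B 0%F f = 0%F.
Proof.
replace (B 0%F f) with (B (0 * 0)%F f) by (f_equal; ring).
rewrite (inv_scal_l B HB); ring.
Qed.

Lemma inv_0_r f : B f 0%F = 0%F.
Proof.
replace (B f 0%F) with (B f (0 * 0)%F) by (f_equal; ring).
rewrite (inv_scal_r B HB); ring.
Qed.

(** As x d/dy vanishes at the origin, invariance under it is there a relation
    between values of [B]. The images under x d/dy are separate arguments so
    that they can be given in expanded form. *)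
Lemma ev_xdy f g f' g' :
  (x * dy f = f')%F -> (x * dy g = g')%F ->
  Cplus (ev (B f' g)) (ev (B f g')) = RtoC 0.
Proof.
intros <- <-.
pose proof (f_equal ev (inv_xdy B HB f g)) as E.
unfold ev in *; simpl in E; rewrite <- E; apply Cmult_0_l.
Qed.

Lemma ev_xxdy f g f' g' :
  (x * x * dy f = f')%F -> (x * x * dy g = g')%F ->
  Cplus (ev (B f' g)) (ev (B f g')) = RtoC 0.
Proof.
intros <- <-.
pose proof (f_equal ev (inv_xxdy B HB f g)) as E.
unfold ev in *; simpl in E; rewrite <- E; rewrite !Cmult_0_l; reflexivity.
Qed.

Ltac expand H :=
  rewrite ?(inv_plus_l B HB), ?(inv_plus_r B HB), ?inv_0_l, ?inv_0_r,
    ?ev_plus, ?ev_0, ?Cplus_0_l, ?Cplus_0_r in H.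

(** Up to [ev_xx_yy], the lemmas kill, one after the other, coefficients of the
    symbol of [B] of degree two in xi and degree two in eta. The chain starts here
    because x d/dy annihilates x, so that applying it to the pair y^3, x gives
    a relation with a single term. *)
Lemma ev_xyy_x : ev (B (x * y * y)%F x) = RtoC 0.
Proof.
assert (H := ev_xdy (y * y * y) x (x * y * y + x * y * y + x * y * y) 0
  ltac:(derive) ltac:(derive)).
expand H.
set (a := ev _) in *.
replace a with (Cdiv (Cplus (Cplus a a) a) (RtoC 3)).
- rewrite H; unfold Cdiv; ring.
- apply injective_projections; simpl; field.
Qed.

Lemma ev_xxy_y : ev (B (x * x * y)%F y) = RtoC 0.
Proof.
assert (H := ev_xdy (x * y * y) y (x * x * y + x * x * y) x
  ltac:(derive) ltac:(derive)).
expand H; rewrite ev_xyy_x, Cplus_0_r in H.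
exact (Cplus_self_0 _ H).
Qed.

(** The x d/dy relations alone would allow the square of
    xi1 eta2 - xi2 eta1; x^2 d/dy is what excludes it. *)
Lemma ev_yy_xx : ev (B (y * y)%F (x * x)%F) = RtoC 0.
Proof.
assert (H := ev_xxdy (y * y) y (x * x * y + x * x * y) (x * x)
  ltac:(derive) ltac:(derive)).
expand H; rewrite ev_xxy_y, !Cplus_0_l in H; exact H.
Qed.

Lemma ev_xy_xy : ev (B (x * y)%F (x * y)%F) = RtoC 0.
Proof.
assert (H := ev_xdy (y * y) (x * y) (x * y + x * y) (x * x)
  ltac:(derive) ltac:(derive)).
expand H; rewrite ev_yy_xx, Cplus_0_r in H.
exact (Cplus_self_0 _ H).
Qed.

Lemma ev_xx_yy : ev (B (x * x)%F (y * y)%F) = RtoC 0.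
Proof.
assert (H := ev_xdy (x * y) (y * y) (x * x) (x * y + x * y)
  ltac:(derive) ltac:(derive)).
expand H; rewrite ev_xy_xy, !Cplus_0_r in H; exact H.
Qed.

Lemma ev_xy_x : ev (B (x * y)%F x) = RtoC 0.
Proof.
assert (H := ev_xdy (y * y) x (x * y + x * y) 0
  ltac:(derive) ltac:(derive)).
expand H; exact (Cplus_self_0 _ H).
Qed.

Lemma ev_xx_y : ev (B (x * x)%F y) = RtoC 0.
Proof.
assert (H := ev_xdy (x * y) y (x * x) x ltac:(derive) ltac:(derive)).
rewrite ev_xy_x, Cplus_0_r in H; exact H.
Qed.

Lemma ev_xx_1 : ev (B (x * x)%F 1%F) = RtoC 0.
Proof.
assert (H := ev_xdy (x * y) 1 (x * x) 0 ltac:(derive) ltac:(derive)).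
expand H; exact H.
Qed.

Lemma ev_x_1 : ev (B x 1%F) = RtoC 0.
Proof.
assert (H := ev_xdy y 1 x 0 ltac:(derive) ltac:(derive)).
expand H; exact H.
Qed.

(** The part of the symbol of bidegree (1, 1) is a multiple of
    xi1 eta2 - xi2 eta1. *)
Lemma ev_x_y_skew : Cplus (ev (B x y)) (ev (B y x)) = RtoC 0.
Proof. apply ev_xdy; derive. Qed.

Ltac partials := apply eq_of_partials;
  [ rewrite (inv_dx B HB) | rewrite (inv_dy B HB) | ].

Let k := ev (B 1%F 1%F).
Let l := ev (B 1%F y).
Let l' := ev (B y 1%F).
Let b := ev (B x y).

Lemma B_1_1 : B 1%F 1%F = cst k.
Proof.
apply const_of_partials_0;
  [rewrite (inv_dx B HB) | rewrite (inv_dy B HB)];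
  rewrite ?dx_const, ?dy_const, inv_0_l, inv_0_r; ring.
Qed.

Lemma B_1_y : B 1%F y = (cst k * y + cst l)%F.
Proof.
partials.
- rewrite dx_const, dx_y, inv_0_l, inv_0_r; derive.
- rewrite dy_const, dy_y, inv_0_l, B_1_1; derive.
- unfold k, l, l', b, ev; simpl; ring.
Qed.

Lemma B_y_1 : B y 1%F = (cst k * y + cst l')%F.
Proof.
partials.
- rewrite dx_const, dx_y, inv_0_l, inv_0_r; derive.
- rewrite dy_const, dy_y, inv_0_r, B_1_1; derive.
- unfold k, l, l', b, ev; simpl; ring.
Qed.

Lemma B_y_y :
  B y y = (cst k * (y * y) + (cst l + cst l') * y + cst (ev (B y y)))%F.
Proof.
partials.
- rewrite dx_y, inv_0_l, inv_0_r; derive.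
- rewrite dy_y, B_1_y, B_y_1; derive.
- unfold k, l, l', b, ev; simpl; ring.
Qed.

Lemma B_x_1 : B x 1%F = (cst k * x)%F.
Proof.
partials.
- rewrite dx_const, dx_x, inv_0_r, B_1_1; derive.
- rewrite dy_const, dy_x, inv_0_l, inv_0_r; derive.
- rewrite ev_x_1; unfold k, l, l', b, ev; simpl; ring.
Qed.

Lemma B_xx_1 : B (x * x)%F 1%F = (cst k * (x * x))%F.
Proof.
partials.
- replace (dx (x * x)%F) with (x + x)%F by derive.
  rewrite dx_const, inv_0_r, (inv_plus_l B HB), B_x_1; derive.
- replace (dy (x * x)%F) with 0%F by derive.
  rewrite dy_const, inv_0_l, inv_0_r; derive.
- rewrite ev_xx_1; unfold k, l, l', b, ev; simpl; ring.
Qed.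

Lemma B_x_y :
  B x y = (cst k * (x * y) + cst l * x + cst b)%F.
Proof.
partials.
- rewrite dx_x, dx_y, inv_0_r, B_1_y; derive.
- rewrite dy_x, dy_y, inv_0_l, B_x_1; derive.
- unfold k, l, l', b, ev; simpl; ring.
Qed.

Lemma B_xx_y :
  B (x * x)%F y = (cst k * (x * x * y) + cst l * (x * x)
    + (cst b * x + cst b * x))%F.
Proof.
partials.
- replace (dx (x * x)%F) with (x + x)%F by derive.
  rewrite dx_y, inv_0_r, (inv_plus_l B HB), B_x_y; derive.
- replace (dy (x * x)%F) with 0%F by derive.
  rewrite dy_y, inv_0_l, B_xx_1; derive.
- rewrite ev_xx_y; unfold k, l, l', b, ev; simpl; ring.
Qed.

(** Of the terms of B(x^2, y) only 2 b x pairs with y to give a nonzero value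
    at the origin, namely b once more. *)
Lemma ev_B_B_xx_y :
  ev (B (B (x * x)%F y) y) = Cplus (Cmult b b) (Cmult b b).
Proof.
rewrite B_xx_y, !(inv_plus_l B HB), !(inv_scal_l B HB), !ev_plus, !ev_cst.
rewrite ev_xxy_y, ev_xx_y; fold b; ring.
Qed.

Lemma ev_B_xx_B : ev (B (x * x)%F (B y y)) = RtoC 0.
Proof.
rewrite B_y_y.
replace (cst (ev (B y y))) with (cst (ev (B y y)) * 1)%F by ring.
replace ((cst l + cst l') * y)%F
  with (cst l * y + cst l' * y)%F by ring.
rewrite !(inv_plus_r B HB), !(inv_scal_r B HB), !ev_plus, !ev_cst.
rewrite ev_xx_yy, ev_xx_y, ev_xx_1; ring.
Qed.

End InvariantBilinear.

(** * The action of the Lie algebra *)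

Definition cubic (a b c d : R) : Cinf :=
  plus (scal (RtoC a) (pow_n coord_x 3))
    (plus (scal (RtoC b) (pow_n coord_x 2))
    (plus (scal (RtoC c) coord_x)
    (plus (scal (RtoC d) coord_y)
          (scal (RtoC 0) (one : Cinf))))).

Lemma in_g_cubic a b c d : in_g (cubic a b c d).
Proof. exists a, b, c, d, 0%R; reflexivity. Qed.

Lemma bracket_cubic a b c d f :
  bracket (cubic a b c d) f =
  ((cst (RtoC (3 * a)) * (x * x) + cst (RtoC (2 * b)) * x + cst (RtoC c)) * dy f
   + - (cst (RtoC d) * dx f))%F.
Proof.
set (X := (cst (RtoC a) * (x * (x * (x * 1))) + (cst (RtoC b) * (x * (x * 1))
  + (cst (RtoC c) * x + (cst (RtoC d) * y + cst (RtoC 0) * 1))))%F).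
change (dx X * dy f + - (dy X * dx f) =
  ((cst (RtoC (3 * a)) * (x * x) + cst (RtoC (2 * b)) * x + cst (RtoC c)) * dy f
   + - (cst (RtoC d) * dx f)))%F.
replace (cst (RtoC (3 * a))) with (cst (RtoC a) + cst (RtoC a) + cst (RtoC a))%F
  by (apply Cinf_ext; intros; apply injective_projections; simpl; ring).
replace (cst (RtoC (2 * b))) with (cst (RtoC b) + cst (RtoC b))%F
  by (apply Cinf_ext; intros; apply injective_projections; simpl; ring).
unfold X; derive.
Qed.

(** * Formal power series *)

Lemma sum_n_zero {G : AbelianMonoid} (u : nat -> G) n :
  (forall m, (m <= n)%nat -> u m = zero) -> sum_n u n = zero.
Proof.
intros H; induction n as [|n IH].
- rewrite sum_O; apply H; auto.
- rewrite sum_Sn, IH, H; auto using plus_zero_l.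
Qed.

Lemma sum_n_single {G : AbelianMonoid} (u : nat -> G) j n :
  (j <= n)%nat -> (forall m, m <> j -> u m = zero) -> sum_n u n = u j.
Proof.
intros Hj H; induction n as [|n IH].
- inversion Hj; apply sum_O.
- rewrite sum_Sn; destruct (Nat.eq_dec j (S n)) as [-> | Hne].
  + rewrite sum_n_zero; [apply plus_zero_l | intros m Hm; apply H; lia].
  + rewrite IH, (H (S n)); [apply plus_zero_r | lia | lia].
Qed.

Definition monomial (c : C) (j : nat) : Ch :=
  fun n => if Nat.eq_dec n j then c else RtoC 0.

Lemma scal_monomial c j F n :
  (j <= n)%nat -> Cinfh_scal (monomial c j) F n = (cst c * F (n - j)%nat)%F.
Proof.
intros Hj; unfold Cinfh_scal, monomial; rewrite (sum_n_single _ j); auto.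
- destruct (Nat.eq_dec j j) as [_ | Hne]; [reflexivity | now elim Hne].
- intros m Hm; destruct (Nat.eq_dec m j) as [E | _]; [now elim Hm |].
  apply (scal_zero_l (V := Cinf_ModuleSpace)).
Qed.

Lemma scal_monomial_lt c j F n :
  (n < j)%nat -> Cinfh_scal (monomial c j) F n = 0%F.
Proof.
intros Hj; unfold Cinfh_scal, monomial.
change 0%F with (zero : Cinf); apply sum_n_zero; intros m Hm.
destruct (Nat.eq_dec m j) as [E | _]; [lia |].
apply (scal_zero_l (V := Cinf_ModuleSpace)).
Qed.

Lemma embed_plus f g : embed (f + g)%F = Cinfh_plus (embed f) (embed g).
Proof.
apply functional_extensionality; intros [|n]; [reflexivity |].
apply Cinf_ext; intros; simpl; ring.
Qed.

Lemma embed_scal c f :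
  embed (cst c * f)%F = Cinfh_scal (monomial c 0) (embed f).
Proof.
apply functional_extensionality; intros n.
rewrite scal_monomial by lia; rewrite Nat.sub_0_r.
destruct n as [|n]; [reflexivity |].
apply Cinf_ext; intros; simpl; ring.
Qed.

Definition shift (F : Cinfh) : Cinfh := fun n => F (S n).

(** Iterating this decomposition n + 1 times determines the coefficient of
    hbar^n in a product of series, so linearity over formal series reduces
    such products to products of functions. *)
Lemma series_split (F : Cinfh) :
  F = Cinfh_plus (embed (F 0%nat)) (Cinfh_scal (monomial (RtoC 1) 1) (shift F)).
Proof.
apply functional_extensionality; intros [|n]; unfold Cinfh_plus.
- rewrite scal_monomial_lt by lia.
  change (F 0%nat = (F 0%nat + 0)%F); ring.
- rewrite scal_monomial by lia; simpl embed.
  replace (S n - 1)%nat with n by lia.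
  change (F (S n) = (0 + 1 * F (S n))%F); ring.
Qed.

(** * Coefficients of an invariant star product *)

Section StarProduct.

Variable P : star_product.

Lemma star_0_l F G : P F G 0%nat = P (embed (F 0%nat)) G 0%nat.
Proof.
rewrite (series_split F) at 1; rewrite star_plus_l, star_scal_l.
unfold Cinfh_plus; rewrite scal_monomial_lt by lia.
change (P (embed (F 0%nat)) G 0%nat + 0 = P (embed (F 0%nat)) G 0%nat)%F; ring.
Qed.

Lemma star_S_l F G n :
  P F G (S n) = (P (embed (F 0%nat)) G (S n) + P (shift F) G n)%F.
Proof.
rewrite (series_split F) at 1; rewrite star_plus_l, star_scal_l.
unfold Cinfh_plus; rewrite scal_monomial by lia.
replace (S n - 1)%nat with n by lia.
change (P (embed (F 0%nat)) G (S n) + 1 * P (shift F) G n =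
  P (embed (F 0%nat)) G (S n) + P (shift F) G n)%F; ring.
Qed.

Lemma star_0_r F G : P F G 0%nat = P F (embed (G 0%nat)) 0%nat.
Proof.
rewrite (series_split G) at 1; rewrite star_plus_r, star_scal_r.
unfold Cinfh_plus; rewrite scal_monomial_lt by lia.
change (P F (embed (G 0%nat)) 0%nat + 0 = P F (embed (G 0%nat)) 0%nat)%F; ring.
Qed.

Lemma star_S_r F G n :
  P F G (S n) = (P F (embed (G 0%nat)) (S n) + P F (shift G) n)%F.
Proof.
rewrite (series_split G) at 1; rewrite star_plus_r, star_scal_r.
unfold Cinfh_plus; rewrite scal_monomial by lia.
replace (S n - 1)%nat with n by lia.
change (P F (embed (G 0%nat)) (S n) + 1 * P F (shift G) n =
  P F (embed (G 0%nat)) (S n) + P F (shift G) n)%F; ring.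
Qed.

Local Notation B := (star_coef P).

Lemma star_coef_0 f g : B 0 f g = (f * g)%F.
Proof. exact (star_classical P f g). Qed.

Lemma star_2_l F h :
  P F (embed h) 2%nat =
  (B 2 (F 0%nat) h + (B 1 (F 1%nat) h + F 2%nat * h))%F.
Proof.
rewrite <- (star_coef_0 (F 2%nat) h), (star_S_l F), (star_S_l (shift F)).
rewrite (star_0_l (shift (shift F))); reflexivity.
Qed.

Lemma star_2_r f G :
  P (embed f) G 2%nat =
  (B 2 f (G 0%nat) + (B 1 f (G 1%nat) + f * G 2%nat))%F.
Proof.
rewrite <- (star_coef_0 f (G 2%nat)), (star_S_r _ G), (star_S_r _ (shift G)).
rewrite (star_0_r _ (shift (shift G))); reflexivity.
Qed.

Lemma associative_order_2 f g h :
  (B 2 (f * g) h + (B 1 (B 1 f g) h + B 2 f g * h) =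
   B 2 f (g * h) + (B 1 f (B 1 g h) + f * B 2 g h))%F.
Proof.
pose proof (f_equal (fun F => F 2%nat)
  (star_assoc P (embed f) (embed g) (embed h))) as E; cbv beta in E.
rewrite (star_2_l (P (embed f) (embed g)) h),
  (star_2_r f (P (embed g) (embed h))) in E.
rewrite <- (star_coef_0 f g), <- (star_coef_0 g h); exact E.
Qed.

(** The vector fields d/dx, d/dy, x d/dy and x^2 d/dy have the Hamiltonians
    -y, x, x^2/2 and x^3/3. *)
Lemma star_coef_invariant_bilinear (Hinv : g_invariant P) r :
  invariant_bilinear (B r).
Proof.
assert (Hbr : forall a b c d f g,
  bracket (cubic a b c d) (B r f g) =
  (B r (bracket (cubic a b c d) f) g + B r f (bracket (cubic a b c d) g))%F).
{ intros a b c d f g.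
  exact (f_equal (fun F => F r) (Hinv _ (in_g_cubic a b c d) f g)). }
assert (Hfield : forall a b c d (V : Cinf -> Cinf),
  (forall f, V f = bracket (cubic a b c d) f) ->
  forall f g, V (B r f g) = (B r (V f) g + B r f (V g))%F).
{ intros a b c d V HV f g; rewrite !HV; apply Hbr. }
constructor.
- intros f g h; unfold star_coef; rewrite embed_plus, star_plus_l; reflexivity.
- intros f g h; unfold star_coef; rewrite embed_plus, star_plus_r; reflexivity.
- intros c f g; unfold star_coef; rewrite embed_scal, star_scal_l.
  rewrite scal_monomial by lia; rewrite Nat.sub_0_r; reflexivity.
- intros c f g; unfold star_coef; rewrite embed_scal, star_scal_r.
  rewrite scal_monomial by lia; rewrite Nat.sub_0_r; reflexivity.
- apply (Hfield 0 0 0 (-1))%R; intros f; rewrite bracket_cubic.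
  apply Cinf_ext; intros; apply injective_projections; simpl; ring.
- apply (Hfield 0 0 1 0)%R; intros f; rewrite bracket_cubic.
  apply Cinf_ext; intros; apply injective_projections; simpl; ring.
- apply (Hfield 0 (/2) 0 0 (fun f => x * dy f)%F)%R; intros f; rewrite bracket_cubic.
  apply Cinf_ext; intros; apply injective_projections; simpl; field.
- apply (Hfield (/3) 0 0 0 (fun f => x * x * dy f)%F)%R; intros f; rewrite bracket_cubic.
  apply Cinf_ext; intros; apply injective_projections; simpl; field.
Qed.

Lemma ev_star_coef_1_commutator :
  Cminus (ev (B 1 x y)) (ev (B 1 y x)) = Copp Ci.
Proof.
pose proof (f_equal ev (star_semiclassical P x y)) as E.
assert (Ebr : bracket x y = 1%F).
{ change (dx x * dy y + - (dy x * dx y) = 1)%F; derive. }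
rewrite Ebr in E.
transitivity (Cmult (Copp Ci) (RtoC 1)); [exact E | ring].
Qed.

End StarProduct.

Theorem theorem2p2 : ~ (exists S : star_product, g_invariant S).
Proof.
intros [P Hinv].
pose proof (star_coef_invariant_bilinear P Hinv 1) as H1.
pose proof (star_coef_invariant_bilinear P Hinv 2) as H2.
pose proof (f_equal ev (associative_order_2 P (x * x)%F y y)) as E.
pose proof (ev_star_coef_1_commutator P) as Hc.
pose proof (ev_x_y_skew _ H1) as Hs.
rewrite !ev_plus, (ev_xxy_y _ H2), (ev_xx_yy _ H2), (ev_B_B_xx_y _ H1),
  (ev_B_xx_B _ H1) in E.
set (b := ev (star_coef P 1 x y)) in *.
set (b' := ev (star_coef P 1 y x)) in *.
assert (Eb : Cplus b b = Copp Ci).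
{ rewrite <- Hc; replace b' with (Cminus (Cplus b b') b) by ring.
  rewrite Hs; ring. }
assert (Ebb : Cplus (Cmult b b) (Cmult b b) = RtoC 0).
{ transitivity (Cplus (RtoC 0) (Cplus (Cplus (Cmult b b) (Cmult b b)) (RtoC 0)));
    [ring |].
  etransitivity; [|etransitivity; [exact E |]];
    unfold ev; simpl; ring. }
(* 2 b = -i, so twice 2 b^2 is (-i)^2 = i^2. *)
assert (E0 : Cmult Ci Ci = RtoC 0).
{ transitivity (Cmult (RtoC 2) (Cplus (Cmult b b) (Cmult b b))).
  - transitivity (Cmult (Cplus b b) (Cplus b b)); [rewrite Eb |]; ring.
  - rewrite Ebb; ring. }
apply (f_equal fst) in E0; simpl in E0; lra.
Qed.
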